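(* Let $\mathbf{T}=(T_1,\dots,T_n)\in\mathcal{B}_A(\mathcal{H})^n$. Then $$\omega_A^2(\mathbf{T})\le\inf_{\alpha,\beta}\frac{\sqrt{n}}{\alpha+\beta}\,\omega_A\big(\alpha\,\mathbf{T}^{\sharp_A}\mathbf{T}+\beta\,\mathbf{T}\mathbf{T}^{\sharp_A}\big),$$ where the infimum is over all reals $\alpha,\beta\ge0$ with $(\alpha,\beta)\ne(0,0)$.
   Context: $\mathcal{H}$ is a non-trivial complex Hilbert space, $\mathcal{B}(\mathcal{H})$ the bounded linear operators on it, $A\in\mathcal{B}(\mathcal{H})$ a fixed positive operator ($\langle Ax,x\rangle\ge0$ for all $x$), $n\ge 1$ an integer. Put $\langle x,y\rangle_A=\langle Ax,y\rangle$ and $\|x\|_A=\langle Ax,x\rangle^{1/2}$. $\mathcal{B}_A(\mathcal{H})$ is the set of $T\in\mathcal{B}(\mathcal{H})$ for which there is $W\in\mathcal{B}(\mathcal{H})$ with $AW=T^*A$ (equivalently, $\mathcal{R}(T^*A)\subseteq\mathcal{R}(A)$); for such $T$, $T^{\sharp_A}=A^\dagger T^*A$ ($A^\dagger$ the Moore–Penrose inverse) is the unique bounded $W$ with $AW=T^*A$ and $\mathcal{R}(W)\subseteq\overline{\mathcal{R}(A)}$. Every $T\in\mathcal{B}_A(\mathcal{H})$ satisfies $\|Tx\|_A\le c\|x\|_A$ for all $x$, for some $c>0$. $\mathcal{B}_A(\mathcal{H})^n$ is the set of $n$-tuples of elements of $\mathcal{B}_A(\mathcal{H})$; sums, scalar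 multiples and products of tuples are componentwise, and $\mathbf{T}^{\sharp_A}=(T_1^{\sharp_A},\dots,T_n^{\sharp_A})$. For a tuple $\mathbf{T}$, $\omega_A(\mathbf{T})=\sup_{\|x\|_A=1}\big(\sum_{k=1}^n|\langle T_kx,x\rangle_A|^2\big)^{1/2}$. *)

(* Defs.v *)
From HB Require Import structures.
From mathcomp Require Import all_boot all_order all_algebra.
From mathcomp Require Import sesquilinear complex.
From mathcomp Require Import all_classical all_reals all_analysis.

Set Implicit Arguments.
Unset Strict Implicit.
Unset Printing Implicit Defensive.

Import Order.TTheory GRing.Theory Num.Theory numFieldNormedType.Exports.

Local Open Scope classical_set_scope.
Local Open Scope ring_scope.
Local Open Scope complex_scope.

(* A complex Hilbert space is a complete normed space H over R[i] with an inner
   product dot (linear on the left) such that `|x| ^+ 2 = dot x x. Operators are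
   plain functions H -> H, those of B(H) being singled out by bounded_op. *)
Section SemiHilbert.
Variables (R : realType) (H : completeNormedModType R[i]).

Definition hilbert_dot (dot : {dot H for Num.conj}) : Prop :=
  forall x : H, `|x| ^+ 2 = dot x x.

Definition bounded_op (T : H -> H) : Prop :=
  linear T /\ exists M : R, forall x, `|T x| <= M%:C * `|x|.

Variable dot : {dot H for Num.conj}.

(* In R[i], 0 <= z means that z is real and nonnegative. *)
Definition positive_op (A : H -> H) : Prop :=
  bounded_op A /\ forall x, 0 <= dot (A x) x.

Definition orthocomplement (D : set H) : set H :=
  [set x | forall y, D y -> dot x y = 0].

(* T^* y is the vector z with <T x, y> = <x, z> for all x; it exists and is
   unique when T is bounded (Riesz). *)
Definition adjoint (T : H -> H) (y : H) : H :=
  xget 0 [set z | forall x, dot (T x) y = dot x z].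

(* A^dagger y is the vector x of N(A)^perp such that y - A x is in R(A)^perp;
   it is unique when A is linear, and for A bounded it exists exactly when y is
   in the domain R(A) + R(A)^perp of A^dagger. Outside it the value is 0. *)
Definition moore_penrose (A : H -> H) (y : H) : H :=
  xget 0 [set x | orthocomplement [set z | A z = 0] x /\
                  orthocomplement (range A) (y - A x)].

Definition A_dot (A : H -> H) (x y : H) : R[i] := dot (A x) y.

(* Only used for positive A, in which case A_dot A x x is real. *)
Definition A_norm (A : H -> H) (x : H) : R :=
  Num.sqrt (complex.Re (A_dot A x x)).

Definition BA (A T : H -> H) : Prop :=
  bounded_op T /\
  exists W : H -> H, bounded_op W /\ forall x, A (W x) = adjoint T (A x).

Definition A_adjoint (A T : H -> H) : H -> H :=
  moore_penrose A \o adjoint T \o A.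

(* The supremum is taken in R. The set is bounded above for tuples of operators
   that are bounded for the seminorm of A, in particular for tuples of BA A. If
   A = 0 the set is empty, and its supremum is then 0. *)
Definition A_numerical_radius (A : H -> H) (n : nat) (T : 'I_n -> H -> H) : R :=
  sup [set Num.sqrt (\sum_(k < n) complex.Re `|A_dot A (T k x) x| ^+ 2)
      | x in [set x | A_norm A x = 1]].

End SemiHilbert.

(* Main.v *)
(** Let S be the A-adjoint of T, so that <Tx, y>_A = <x, Sy>_A. If |x|_A = 1,
    Cauchy-Schwarz for the semidefinite form <., .>_A bounds |<Tx, x>_A|^2 both
    by |Tx|_A^2 = <STx, x>_A and by |Sx|_A^2 = <TSx, x>_A. Taking the convex
    combination, summing over the tuple and applying Cauchy-Schwarz in R^n gives
    the inequality at each x. Passing to the supremum requires the right-hand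
    radius to be finite, that is, T and S to be bounded for the seminorm; this
    is the Reid-Lax argument: if V is bounded and A-symmetric then
    |V^m x|_A^2 <= |V^(2m) x|_A, so |Vx|_A cannot exceed the operator norm of V.
    The adjoint and the Moore-Penrose inverse exist by the projection theorem. *)

Require Import Defs.
From HB Require Import structures.
From mathcomp Require Import all_boot all_order all_algebra.
From mathcomp Require Import sesquilinear complex.
From mathcomp Require Import all_classical all_reals all_analysis.
From mathcomp Require Import ring lra.
Set Implicit Arguments.
Unset Strict Implicit.
Unset Printing Implicit Defensive.
Import Order.TTheory GRing.Theory Num.Theory numFieldNormedType.Exports.
Local Open Scope classical_set_scope.
Local Open Scope ring_scope.
Local Open Scope complex_scope.

(** * Elementary inequalities for real sequences, finite sums and complex moduli *)

(** The minimum over [s] is at [Y^-1]; for [Y = 0] the expression is affine in [s]. With [P] the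
    squared modulus of a form value, this is the discriminant step of Cauchy-Schwarz. *)
Lemma quadratic_ge0_bound (F : realFieldType) (X P Y : F) : 0 <= Y ->
  (forall s, 0 <= X - s * P *+ 2 + s ^+ 2 * P * Y) -> P <= X * Y.
Proof.
rewrite le_eqVlt => /predU1P[<-|Y0] h.
  rewrite mulr0 leNgt; apply/negP => P0.
  have := h ((X + 1) / (P *+ 2)).
  have -> : (X + 1) / (P *+ 2) * P *+ 2 = X + 1 by field; rewrite gt_eqF.
  rewrite mulr0 addr0.
  lra.
have := h Y^-1.
have -> : X - Y^-1 * P *+ 2 + Y^-1 ^+ 2 * P * Y = X - P / Y.
  by field; rewrite gt_eqF.
by rewrite subr_ge0 ler_pdivrMr.
Qed.

(** If [v 0 > 1], repeated squaring forces at least linear growth, which is unbounded in an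
    archimedean field. *)
Lemma squaring_bounded_le1 (F : archiRealFieldType) (v : nat -> F) (K : F) :
  (forall m, v m ^+ 2 <= v m.+1) -> (forall m, v m <= K) -> v 0%N <= 1.
Proof.
move=> v2 vK; rewrite leNgt; apply/negP => v1.
(* Bernoulli-type induction: only [(1 + a) ^+ 2 >= 1 + 2 a] with [a >= v 0 - 1] is used. *)
have grow m : 1 + m.+1%:R * (v 0%N - 1) <= v m.
  elim: m => [|m ih]; first by rewrite mul1r addrC subrK.
  apply: le_trans (v2 m).
  have m0 : (0 : F) <= m%:R by rewrite ler0n.
  rewrite !mulrSr in ih *.
  have md : 0 <= m%:R * (v 0%N - 1) by rewrite mulr_ge0// subr_ge0 ltW.
  set a := (m%:R + 1) * (v 0%N - 1) in ih *.
  have aE : a = m%:R * (v 0%N - 1) + (v 0%N - 1) by rewrite /a mulrDl mul1r.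
  have a0 : 0 <= a by rewrite aE addr_ge0// subr_ge0 ltW.
  have : (1 + a) ^+ 2 <= v m ^+ 2 by apply: lerXn2r; rewrite ?nnegrE//; lra.
  have : 0 <= a ^+ 2 by exact: sqr_ge0.
  rewrite sqrrD expr1n mul1r (mulrDl _ 1) mul1r -/a; lra.
have /archi_boundP : 0 <= K / (v 0%N - 1).
  rewrite divr_ge0 ?subr_ge0 ?(ltW v1)//.
  exact: le_trans ler01 (le_trans (ltW v1) (vK _)).
set m := Num.bound _; rewrite ltr_pdivrMr ?subr_gt0// => Km.
have := le_trans (grow m) (vK m); rewrite mulrSr; nra.
Qed.

Lemma sqr_sum_le (F : realFieldType) (n : nat) (d : 'I_n -> F) :
  (\sum_k d k) ^+ 2 <= n%:R * \sum_k d k ^+ 2.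
Proof.
case: n d => [|n] d; first by rewrite !big_ord0 expr0n mulr0.
set s := \sum_k d k; set Q := \sum_k _.
have : 0 <= \sum_k (n.+1%:R * d k - s) ^+ 2 by apply: sumr_ge0 => k _; exact: sqr_ge0.
(* Variance identity: the gap in the inequality is a sum of squares up to a positive factor. *)
have -> : \sum_k (n.+1%:R * d k - s) ^+ 2 = n.+1%:R * (n.+1%:R * Q - s ^+ 2).
  transitivity (\sum_k (n.+1%:R ^+ 2 * d k ^+ 2 + (- (n.+1%:R * s *+ 2) * d k + s ^+ 2))).
    by apply: eq_bigr => k _; ring.
  rewrite 2!big_split/= -!mulr_sumr sumr_const card_ord -/s -/Q -mulr_natl; ring.
by rewrite pmulr_rge0 ?ltr0Sn// subr_ge0.
Qed.

Lemma Re_norm_real (R : rcfType) (r : R) : complex.Re `|r%:C| = `|r|.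
Proof. by rewrite normc_def/= expr0n addr0 sqrtr_sqr. Qed.

Lemma normc_sqr (R : rcfType) (z : R[i]) : (complex.Re `|z| ^+ 2)%:C = z * Num.conj z.
Proof. by rewrite -normCK -[in RHS](RRe_real (normr_real z)) rmorphXn. Qed.

Lemma normc_sqrD_le (R : rcfType) (a b : R[i]) :
  complex.Re `|a + b| ^+ 2 <= (complex.Re `|a| ^+ 2 + complex.Re `|b| ^+ 2) *+ 2.
Proof.
suff <- : complex.Re `|a + b| ^+ 2 + complex.Re `|a - b| ^+ 2 =
  (complex.Re `|a| ^+ 2 + complex.Re `|b| ^+ 2) *+ 2 by rewrite lerDl sqr_ge0.
apply: complexI; rewrite rmorphMn !rmorphD/= !normc_sqr !rmorphD rmorphN/=; ring.
Qed.

(** * Positive semidefinite Hermitian forms, to be applied to both [dot] and [A_dot] *)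

Section PositiveForm.
Variables (R : realType) (U : lmodType R[i]) (f : U -> U -> R[i]).
Hypotheses (f_linear : forall y, scalar (f^~ y))
  (f_herm : forall x y, f x y = Num.conj (f y x))
  (f_ge0 : forall x, 0 <= f x x).

Definition form_sqr (x : U) : R := complex.Re (f x x).

Lemma form_sqrE x : (form_sqr x)%:C = f x x.
Proof. by rewrite /form_sqr RRe_real// ger0_real. Qed.

Lemma form_sqr_ge0 x : 0 <= form_sqr x.
Proof. by rewrite -ler0c form_sqrE. Qed.

Lemma sesquiDl x y z : f (x + y) z = f x z + f y z.
Proof. by have := f_linear z 1 x y; rewrite scale1r mul1r. Qed.

Lemma sesquiZl a x z : f (a *: x) z = a * f x z.
Proof.
have f0 : f 0 z = 0.
  by apply: (addrI (f 0 z)); rewrite -sesquiDl !addr0.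
by have := f_linear z a x 0; rewrite /= f0 !addr0.
Qed.

Lemma sesquiDr x y z : f x (y + z) = f x y + f x z.
Proof. by rewrite !(f_herm x) sesquiDl rmorphD. Qed.

Lemma sesquiZr a x z : f x (a *: z) = Num.conj a * f x z.
Proof. by rewrite !(f_herm x) sesquiZl rmorphM. Qed.

(** Putting [f x y] in the coefficient of [y] makes the cross terms real, which leaves the real
    quadratic in [s] of [quadratic_ge0_bound]. *)
Lemma form_sqr_shift x y s :
  form_sqr (x - (s%:C * f x y) *: y) = form_sqr x
    - s * complex.Re `|f x y| ^+ 2 *+ 2
    + s ^+ 2 * complex.Re `|f x y| ^+ 2 * form_sqr y.
Proof.
move: (complex.Re _ ^+ 2) (normc_sqr (f x y)) => P PE; apply: complexI.
rewrite 2!rmorphD/= rmorphN rmorphMn !rmorphM/= !form_sqrE !PE.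
rewrite -scaleNr !(sesquiDl, sesquiDr, sesquiZl, sesquiZr) (f_herm y x).
rewrite rmorphN rmorphM/=.
have -> : Num.conj s%:C = s%:C by apply/CrealP; rewrite complex_real.
ring.
Qed.

Lemma form_sqrZ a x : form_sqr (a *: x) = complex.Re `|a| ^+ 2 * form_sqr x.
Proof.
apply: complexI; rewrite rmorphM/= !form_sqrE normc_sqr sesquiZl sesquiZr; ring.
Qed.

Lemma form_parallelogram x y :
  form_sqr (x + y) + form_sqr (x - y) = (form_sqr x + form_sqr y) *+ 2.
Proof.
apply: complexI; rewrite rmorphMn !rmorphD/= !form_sqrE -scaleN1r.
rewrite !(sesquiDl, sesquiDr, sesquiZl, sesquiZr) rmorphN rmorph1; ring.
Qed.

Lemma form_CauchySchwarz x y :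
  complex.Re `|f x y| ^+ 2 <= form_sqr x * form_sqr y.
Proof.
apply: quadratic_ge0_bound => [|s]; first exact: form_sqr_ge0.
by rewrite -form_sqr_shift form_sqr_ge0.
Qed.

End PositiveForm.

(** * Hilbert space geometry: bounded maps, projection, Riesz representation, adjoints *)

Lemma norm_bound_gt0 (R : realType) (V W : normedModType R[i]) (h : V -> W) :
  (exists M : R, forall x, `|h x| <= M%:C * `|x|) ->
  exists2 K : R, 0 < K & forall x, `|h x| <= K%:C * `|x|.
Proof.
move=> [M hM]; exists (`|M| + 1) => [|x]; first by rewrite ltr_wpDl.
apply: le_trans (hM x) _; apply: ler_wpM2r => //.
by rewrite lecR (le_trans (ler_norm _))// lerDl.
Qed.

Lemma bounded_op_comp (R : realType) (H : completeNormedModType R[i])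
    (S T : H -> H) : bounded_op S -> bounded_op T -> bounded_op (S \o T).
Proof.
move=> [Slin /norm_bound_gt0[M M0 SM]] [Tlin [N TN]]; split.
  by move=> a u v /=; rewrite Tlin Slin.
exists (M * N) => u /=; apply: le_trans (SM _) _.
by rewrite rmorphM/= -mulrA ler_wpM2l// ler0c ltW.
Qed.

Section Hilbert.
Variables (R : realType) (H : completeNormedModType R[i]).
Variables (dot : {dot H for Num.conj}) (Hdot : hilbert_dot dot).

Lemma dot_scalar y : scalar (dot^~ y).
Proof. by move=> a u v; rewrite linearPl. Qed.

Lemma dot_conj x y : dot x y = Num.conj (dot y x).
Proof. by rewrite hermC expr0 mul1r. Qed.

Lemma dot_ge0 x : 0 <= dot x x. Proof. exact: dnorm_ge0. Qed.

Local Notation q := (form_sqr dot).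

Lemma norm_form_sqr (x : H) : `|x| ^+ 2 = (q x)%:C.
Proof. by rewrite Hdot form_sqrE//; exact: dot_ge0. Qed.

Lemma norm_lt_form_sqr (x : H) (e : R) : 0 < e ->
  (`|x| < e%:C) = (q x < e ^+ 2).
Proof.
move=> e0; rewrite -(@ltr_pXn2r _ 2)// ?nnegrE ?normr_ge0 ?ler0c ?ltW//.
by rewrite norm_form_sqr -rmorphXn/= ltcR.
Qed.

(** A minimizing sequence is Cauchy by the parallelogram law. Orthogonality at its limit is obtained
    from approximate orthogonality along the sequence. *)
Lemma hilbert_projection (N : set H) : N 0 ->
  (forall a x y, N x -> N y -> N (a *: x + y)) -> closed N ->
  forall x, exists2 y, N y & forall z, N z -> dot (x - y) z = 0.
Proof.
move=> N0 Nlin Ncl x.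
have NB a u v : N u -> N v -> N (u + a *: v) by move=> Nu Nv; rewrite addrC; exact: Nlin.
have q_ge0 := form_sqr_ge0 dot_ge0.
pose D := [set q (x - y) | y in N]; pose d := inf D.
have lbD : has_lbound D by exists 0 => _ [y _ <-]; exact: q_ge0.
have dle y : N y -> d <= q (x - y) by move=> Ny; apply: ge_inf => //; exists y.
have /choice[y_ y_P] (n : nat) : exists y, N y /\ q (x - y) < d + n.+1%:R^-1.
  have [||_ [y Ny <-]] := @inf_adherent _ D n.+1%:R^-1.
  - by rewrite invr_gt0.
  - by split => //; exists (q (x - 0)), 0.
  by exists y.
have y_dist m n : q (y_ m - y_ n) < (m.+1%:R^-1 + n.+1%:R^-1) *+ 2.
  have /= := form_parallelogram dot_scalar dot_conj dot_ge0 (x - y_ m) (x - y_ n).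
  have -> : x - y_ m - (x - y_ n) = (-1) *: (y_ m - y_ n).
    by rewrite opprB addrC addrA subrK scaleN1r opprB.
  (* The midpoint of [y_ m] and [y_ n] lies in [N], so its squared distance to [x] is at least
     [d]. *)
  have -> : x - y_ m + (x - y_ n) = 2 *: (x - (2^-1 *: y_ m + 2^-1 *: y_ n)).
    rewrite scalerBr -scalerDr scalerA divff// scale1r scaler_nat mulr2n.
    by rewrite opprD addrACA.
  rewrite !(form_sqrZ dot_scalar dot_conj dot_ge0).
  have -> : complex.Re `|-1 : R[i]| = 1 by rewrite normrN1.
  have -> : complex.Re `|2 : R[i]| = 2 by rewrite normr_nat.
  have [Nm m1] := y_P m; have [Nn n1] := y_P n.
  have : d <= q (x - (2^-1 *: y_ m + 2^-1 *: y_ n)).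
    apply/dle/Nlin => //; rewrite -[_ *: _]addr0; exact: Nlin.
  move: m1 n1; rewrite expr1n mul1r expr2 -natrM.
  move: (m.+1%:R^-1) (n.+1%:R^-1) (q _) (q _) (q _) (q _) => *; lra.
have eventually_inv (e : R) : 0 < e -> exists m, forall n, (m <= n)%N -> n.+1%:R^-1 < e.
  move=> e0; exists (Num.bound e^-1) => n mn.
  rewrite invf_plt ?posrE ?ltr0Sn//.
  apply: lt_le_trans (archi_boundP _) _; first by rewrite invr_ge0 ltW.
  by rewrite ler_nat ltnW.
have : cvg (y_ @ \oo).
  apply: cauchy_cvg; apply: cauchy_exP => e e0.
  have eE : e = (complex.Re e)%:C by rewrite RRe_real// gtr0_real.
  have {}e0 : 0 < complex.Re e by rewrite -ltcR -eE.
  have [m mP] := eventually_inv (complex.Re e ^+ 2 / 4) ltac:(by rewrite divr_gt0// exprn_gt0).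
  exists (y_ m); exists m => // n /= mn.
  rewrite -ball_normE /ball_/= eE norm_lt_form_sqr//.
  apply: lt_trans (y_dist m n) _.
  have := mP m (leqnn m); have := mP n mn.
  move: (m.+1%:R^-1) (n.+1%:R^-1) => a b; lra.
move=> /cvg_ex[y y_y].
have Ny : N y by apply: (closed_cvg _ Ncl _ _ y_y); apply: nearW => n; have [] := y_P n.
exists y => // z Nz.
pose P := complex.Re `|dot (x - y) z| ^+ 2.
suff P0 : P <= 0.
  have : P = 0 by apply/eqP; rewrite eq_le P0 sqr_ge0.
  move/eqP; rewrite sqrf_eq0 => /eqP Re0.
  by apply/eqP; rewrite -normr_eq0 -(RRe_real (normr_real _)) Re0.
(* Near-minimality of [y_ n] under shifts along [z] bounds the part [x - y_ n]; Cauchy-Schwarz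
   bounds the part [y_ n - y]. *)
have Pbound n : P <= (n.+1%:R^-1 + q (y_ n - y)) * q z *+ 2.
  have dn : complex.Re `|dot (x - y_ n) z| ^+ 2 <= (q (x - y_ n) - d) * q z.
    apply: quadratic_ge0_bound => // s.
    have [Nyn _] := y_P n.
    have := dle _ (NB (s%:C * dot (x - y_ n) z) _ _ Nyn Nz).
    rewrite opprD addrA (form_sqr_shift dot_scalar dot_conj dot_ge0); lra.
  have xyE : x - y = (x - y_ n) + (y_ n - y) by rewrite addrA subrK.
  rewrite /P xyE linearDl; apply: le_trans (normc_sqrD_le _ _) _.
  rewrite lerMn2r/= mulrDl; apply: lerD; last first.
    exact: (form_CauchySchwarz dot_scalar dot_conj dot_ge0).
  apply: le_trans dn _; apply: ler_wpM2r => //.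
  by rewrite lerBlDl ltW//; have [] := y_P n.
rewrite leNgt; apply/negP => Pgt0.
(* With this [e] the bound on [P] is at most [P / 2]; the [+ 1] covers [q z = 0]. *)
pose e := P / (q z + 1) / 8.
have qz1 : 0 < q z + 1 by rewrite ltr_wpDl.
have e0 : 0 < e by rewrite !divr_gt0.
have [m mP] := eventually_inv e e0.
have [n mn yn] : exists2 n, (m <= n)%N & q (y_ n - y) < e.
  have se0 : 0 < Num.sqrt e by rewrite sqrtr_gt0.
  have : 0 < (Num.sqrt e)%:C by rewrite ltcR.
  move: y_y => /cvgrPdist_lt/[apply] -[k _ kP].
  exists (maxn m k); first exact: leq_maxl.
  have := kP (maxn m k) (leq_maxr _ _).
  by rewrite distrC norm_lt_form_sqr// sqr_sqrtr// ltW.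
have /le_lt_trans : P <= (e + e) * q z *+ 2.
  apply: le_trans (Pbound n) _.
  rewrite lerMn2r/=; apply: ler_wpM2r => //; apply: lerD; last exact: ltW.
  exact/ltW/mP.
move=> /(_ P); rewrite ltxx => H0; apply/notF/H0.
have -> : (e + e) * q z *+ 2 = P * (q z / (q z + 1)) / 2 by rewrite /e; field; rewrite gt_eqF.
have : q z / (q z + 1) <= 1 by rewrite ler_pdivrMr// mul1r lerDl.
nra.
Qed.

Lemma norm_CauchySchwarz x y : `|dot x y| <= `|x| * `|y|.
Proof.
rewrite -(@ler_pXn2r _ 2)// ?nnegrE ?mulr_ge0//.
rewrite exprMn !norm_form_sqr -(RRe_real (normr_real (dot x y))) -rmorphM -rmorphXn/= lecR.
exact: form_CauchySchwarz dot_scalar dot_conj dot_ge0 _ _.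
Qed.

(** Where [h x] is nonzero, the ball of radius [|h x| / K] around [x] misses the kernel. *)
Lemma kernel_closed (V : normedModType R[i]) (h : H -> V) (M : R) :
  linear h -> (forall x, `|h x| <= M%:C * `|x|) -> closed [set x | h x = 0].
Proof.
move=> hlin hM x clx /=; apply: contrapT => hx0.
have [K K0 hK] := norm_bound_gt0 (ex_intro _ M hM).
have {}K0 : 0 < K%:C by rewrite ltcR.
have hx : 0 < `|h x| by rewrite normr_gt0; apply/eqP.
have [y [/= hy]] := clx _ (nbhsx_ballx x (`|h x| / K%:C) (divr_gt0 hx K0)).
rewrite -ball_normE /ball_/= ltr_pdivlMr// mulrC => /(le_lt_trans (hK _)).
have -> : h (x - y) = h x.
  by have := hlin (-1) y x; rewrite hy scaler0 add0r scaleN1r addrC.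
by rewrite ltxx.
Qed.

Lemma riesz (phi : H -> R[i]) (M : R) :
  scalar phi -> (forall x, `|phi x| <= M%:C * `|x|) ->
  exists z, forall x, phi x = dot x z.
Proof.
move=> phi_lin phiM.
have phiB a x y : phi (x - a *: y) = phi x - a * phi y.
  by rewrite -scaleNr addrC phi_lin mulNr addrC.
have phi0 : phi 0 = 0 by have := phiB 1 0 0; rewrite scale1r subr0 mul1r subrr.
have [[u phiu]|/forallNP phi_eq0] := pselect (exists u, phi u <> 0); last first.
  by exists 0 => x; rewrite linear0r; apply: contrapT; exact: phi_eq0.
have [|a x y /= hx hy||y /= phiy yP] := @hilbert_projection [set x | phi x = 0] _ _ _ u.
- exact: phi0.
- by rewrite phi_lin hx hy mulr0 addr0.
- exact: (@kernel_closed R[i]^o phi M).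
set w := u - y in yP.
have phiw : phi w != 0.
  by rewrite /w -[y]scale1r phiB phiy mulr0 subr0; apply/eqP.
have w0 : dot w w != 0.
  by rewrite dnorm_eq0; apply: contraNneq phiw => ->; rewrite phi0.
(* The scalar is forced by the case [x = w]; any [x] differs from a multiple of [w] by a kernel
   vector, orthogonal to [w]. *)
exists (Num.conj (phi w / dot w w) *: w) => x.
have : dot w (x - (phi x / phi w) *: w) = 0.
  by apply: yP; rewrite /= phiB divfK// subrr.
rewrite linearBr linearZr_LR/= => /subr0_eq wx.
have -> : phi x = (phi w / dot w w) * dot x w.
  rewrite (dot_conj x w) wx rmorphM/= -dot_conj conjCK; field; exact/andP.
by rewrite linearZr_LR/= conjCK.
Qed.

(** Riesz shows that the set in [adjoint] is inhabited, so [xget] does not return its default. *)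
Lemma adjointP (T : H -> H) : bounded_op T ->
  forall x y, dot (T x) y = dot x (adjoint dot T y).
Proof.
move=> [Tlin [M TM]] x y; rewrite /adjoint.
suff [z zP] : exists z, forall u, dot (T u) y = dot u z.
  by case: xgetP => [z' _ ->//|/(_ z)]; exact.
apply: (@riesz _ (M * complex.Re `|y|)) => [a u v|u].
  by rewrite Tlin linearPl.
apply: le_trans (norm_CauchySchwarz _ _) _.
by rewrite rmorphM/= RRe_real ?normr_real// mulrAC ler_wpM2r.
Qed.

Lemma A_adjointP (A T : H -> H) : bounded_op A -> BA dot A T ->
  forall x, A (A_adjoint dot A T x) = adjoint dot T (A x).
Proof.
move=> [Alin [M AM]] [_ [W [_ AW]]] x; rewrite /A_adjoint /= -AW.
have AB u v : A (u - v) = A u - A v.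
  by rewrite [u - v]addrC [RHS]addrC -(scaleN1r v) -(scaleN1r (A v)) Alin.
have A0 : A 0 = 0 by have := AB 0 0; rewrite !subrr.
rewrite /moore_penrose; case: xgetP => [u _ [_ uP]|noP].
  (* [A (W x) - A u] is both in the range of [A] and orthogonal to it. *)
  apply/esym/subr0_eq/eqP; rewrite -(dnorm_eq0 dot); apply/eqP/uP.
  by exists (W x - u).
(* The Moore-Penrose value exists: subtract from [W x] its projection onto the kernel of [A]. *)
have [|a u v /= hu hv||y /= Ay yP] := @hilbert_projection [set x | A x = 0] _ _ _ (W x).
- exact: A0.
- by rewrite Alin hu hv scaler0 addr0.
- exact: kernel_closed AM.
exfalso; apply: (noP (W x - y)); split => //.
by move=> z _; rewrite AB Ay subr0 subrr linear0l.
Qed.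

End Hilbert.

(** * The semi-inner product of a positive operator and boundedness for its seminorm *)

Section PositiveOperator.
Variables (R : realType) (H : completeNormedModType R[i]).
Variables (dot : {dot H for Num.conj}) (Hdot : hilbert_dot dot).
Variables (A : H -> H) (HA : positive_op dot A).

Lemma A_dot_scalar y : scalar (A_dot dot A ^~ y).
Proof. by move=> a u v; rewrite /A_dot HA.1.1 linearPl. Qed.

Lemma A_dot_ge0 x : 0 <= A_dot dot A x x. Proof. exact: HA.2. Qed.

(** Polarization: the form is real at [x + c *: y], and [c = 1] and [c = 'i] compare the imaginary
    and the real parts. *)
Lemma A_dot_conj x y : A_dot dot A x y = Num.conj (A_dot dot A y x).
Proof.
have real_part c : complex.Im (Num.conj c * A_dot dot A x y + c * A_dot dot A y x) = 0.
  have := ger0_Im (A_dot_ge0 (x + c *: y)).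
  have -> : A_dot dot A (x + c *: y) (x + c *: y) = A_dot dot A x x +
      (c * Num.conj c) * A_dot dot A y y +
      (Num.conj c * A_dot dot A x y + c * A_dot dot A y x).
    rewrite [x + _]addrC /A_dot HA.1.1.
    rewrite !(sesquiDl (dot_scalar dot), sesquiZl (dot_scalar dot)).
    rewrite !(sesquiDr (dot_scalar dot) (dot_conj dot)).
    rewrite !(sesquiZr (dot_scalar dot) (dot_conj dot)); ring.
  have := ger0_Im (A_dot_ge0 x).
  have := ger0_Im (mulr_ge0 (mul_conjC_ge0 c) (A_dot_ge0 y)).
  by rewrite !raddfD/= => -> ->; rewrite !add0r.
have := real_part 1; have := real_part 'i.
case: (A_dot dot A x y) => a b; case: (A_dot dot A y x) => c d.
rewrite rmorph1 !mul1r /= => h1 h2.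
by have -> : a = c by [lra]; have -> : b = - d by lra.
Qed.

Lemma A_norm_eq1 x : A_norm dot A x = 1 -> form_sqr (A_dot dot A) x = 1.
Proof.
move=> x1; rewrite -[LHS]sqr_sqrtr; last exact: form_sqr_ge0 A_dot_ge0 x.
by rewrite -/(A_norm dot A x) x1 expr1n.
Qed.

Local Notation "''[' x , y ]" := (A_dot dot A x y).
Local Notation q := (form_sqr (A_dot dot A)).

Let f_scalar := A_dot_scalar.
Let f_conj := A_dot_conj.
Let f_ge0 := A_dot_ge0.
Let f_CS := form_CauchySchwarz f_scalar f_conj f_ge0.

(** [|x|] may be unbounded on [q x = 1], but the squaring argument only needs a finite bound for
    each [x]; the resulting constant [K ^+ 2] is uniform. *)
Lemma symmetric_form_bounded (S : H -> H) : bounded_op S ->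
  (forall x y, '[S x, y] = '[x, S y]) ->
  exists c : R, forall x, q x = 1 -> q (S x) <= c.
Proof.
move=> [_ /norm_bound_gt0[K K0 SK]] Ssym.
have [_ /norm_bound_gt0[N N0 AN]] := HA.1.
have iterK m u : `|iter m S u| <= (K ^+ m)%:C * `|u|.
  elim: m => [|m ih]; first by rewrite expr0 mul1r.
  rewrite iterS exprS rmorphM -mulrA; apply: le_trans (SK _) _.
  by rewrite ler_wpM2l// ler0c ltW.
have qN u : q u <= N * complex.Re `|u| ^+ 2.
  rewrite -lecR form_sqrE//; apply: le_trans (real_ler_norm _) _; first exact: ger0_real.
  apply: le_trans (norm_CauchySchwarz Hdot _ _) _.
  rewrite rmorphM rmorphXn/= RRe_real ?normr_real// expr2 mulrA.
  by apply: ler_wpM2r.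
have iter_sym m x y : '[iter m S x, y] = '[x, iter m S y].
  by elim: m x y => // m ih x y; rewrite iterS Ssym ih -iterSr.
exists (K ^+ 2) => x x1.
(* The powers of [K ^+ 2] cancel the growth of the iterates and are compatible with squaring. *)
pose v m := q (iter (2 ^ m) S x) / (K ^+ 2) ^+ (2 ^ m).
have q_ge0 := form_sqr_ge0 f_ge0.
have := @squaring_bounded_le1 R v (N * complex.Re `|x| ^+ 2).
have -> : v 0%N = q (S x) / K ^+ 2 by [].
rewrite ler_pdivrMr ?exprn_gt0// mul1r; apply => m.
  rewrite /v expr_div_n expnSr exprM ler_pM2r ?invr_gt0 ?exprn_gt0//.
  (* Symmetry moves half of the iterates to the other side, so the form value is [q] at the
     [2 ^ m]-th iterate. *)
  have := f_CS (iter (2 ^ m * 2) S x) x.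
  rewrite x1 mulr1 muln2 -addnn iterD iter_sym; apply: le_trans.
  by rewrite -form_sqrE// Re_norm_real ger0_norm.
rewrite /v ler_pdivrMr ?exprn_gt0//; apply: le_trans (qN _) _.
rewrite -mulrA; apply: ler_wpM2l; first exact: ltW.
rewrite -exprM mulnC exprM mulrC -exprMn.
apply: lerXn2r; rewrite ?nnegrE ?mulr_ge0 ?exprn_ge0 ?(ltW K0)//.
- by rewrite -ler0c RRe_real ?normr_real.
- by rewrite -ler0c RRe_real ?normr_real.
by rewrite -lecR rmorphM/= !RRe_real ?normr_real//.
Qed.

(** Hermitian symmetry moves [A] onto [y], where [adjoint dot T (A y)] becomes [A (W y)]. *)
Lemma A_dot_adjoint (T W : H -> H) : bounded_op T ->
  (forall x, A (W x) = adjoint dot T (A x)) ->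
  forall x y, '[T x, y] = '[x, W y].
Proof.
move=> Tb AW x y.
rewrite f_conj [RHS]f_conj /A_dot -!dot_conj.
by rewrite (adjointP Hdot Tb) -AW.
Qed.

(* [W] is any solution of [A W = T^* A]; it need not be the A-adjoint. *)
Lemma BA_form_bounded (T : H -> H) : BA dot A T ->
  exists c : R, forall x, q x = 1 ->
    q (T x) <= c /\ q (A_adjoint dot A T x) <= c.
Proof.
move=> TBA; have [Tb [W [Wb AW]]] := TBA.
have TW x y : '[T x, y] = '[x, W y].
  exact: A_dot_adjoint.
have WT x y : '[W x, y] = '[x, T y] by rewrite f_conj -TW -f_conj.
have bound (S S' : H -> H) : bounded_op S -> bounded_op S' ->
    (forall x y, '[S x, y] = '[x, S' y]) ->
  exists c : R, forall x, q x = 1 -> q (S x) <= c.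
  move=> Sb S'b SS'.
  have S'S x y : '[S' x, y] = '[x, S y] by rewrite f_conj -SS' -f_conj.
  have [|c cP] := @symmetric_form_bounded (S' \o S) (bounded_op_comp S'b Sb).
    by move=> x y; rewrite /= S'S SS'.
  (* Here [q (S x) ^+ 2 <= q (S' (S x)) <= c], and [a ^+ 2 <= c] implies [a <= c + 1]. *)
  exists (c + 1) => x x1.
  have := f_CS (S' (S x)) x; rewrite x1 mulr1 S'S -form_sqrE// Re_norm_real.
  have := cP x x1; rewrite /= real_normK ?num_real//.
  have := form_sqr_ge0 f_ge0 (S x); move: (q _) (q _) => a b; nra.
have [c cP] := bound T W Tb Wb TW.
have [c' c'P] := bound W T Wb Tb WT.
exists (Num.max c c') => x x1; rewrite !le_max cP//; split => //.
apply/orP; right; apply: le_trans (c'P x x1).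
(* [W] and the A-adjoint agree after applying [A], so the bound for [W] transfers. *)
have AsW y : '[A_adjoint dot A T x, y] = '[W x, y].
  by rewrite /A_dot (A_adjointP Hdot HA.1 TBA) AW.
by rewrite -lecR !form_sqrE// AsW f_conj AsW -f_conj.
Qed.

(** The A-adjoint relation turns both compositions into squared seminorms, so the modulus drops.
    Cauchy-Schwarz applied to ['[T x, x]] and to ['[x, S x]] gives the two weighted terms. *)
Lemma BA_form_convex_bound (T : H -> H) (x : H) (a b : R) : BA dot A T ->
  q x = 1 -> 0 <= a -> 0 <= b ->
  let S := A_adjoint dot A T in
  complex.Re `|'[a%:C *: S (T x) + b%:C *: T (S x), x]| = a * q (T x) + b * q (S x) /\
  (a + b) * complex.Re `|'[T x, x]| ^+ 2 <= a * q (T x) + b * q (S x).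
Proof.
move=> TBA x1 a0 b0 S.
have TS y z : '[T y, z] = '[y, S z].
  by apply: A_dot_adjoint TBA.1 _ _ _ => u; exact: A_adjointP HA.1 TBA _.
have ST y z : '[S y, z] = '[y, T z] by rewrite f_conj -TS -f_conj.
have q_ge0 := form_sqr_ge0 f_ge0.
split.
  rewrite (sesquiDl f_scalar) !(sesquiZl f_scalar) (ST (T x)) (TS (S x)).
  rewrite -!(form_sqrE f_ge0) -!rmorphM -rmorphD Re_norm_real ger0_norm//.
  by rewrite addr_ge0// mulr_ge0.
rewrite mulrDl; apply: lerD; apply: ler_wpM2l => //.
  by apply: le_trans (f_CS _ _) _; rewrite x1 mulr1.
by rewrite TS; apply: le_trans (f_CS _ _) _; rewrite x1 mul1r.
Qed.

End PositiveOperator.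

(** * The inequality for tuples, from pointwise bounds to suprema *)

Theorem corollary3p16 (R : realType) (H : completeNormedModType R[i])
    (dot : {dot H for Num.conj}) (Hdot : hilbert_dot dot)
    (Hnontrivial : exists x : H, x != 0)
    (A : H -> H) (HA : positive_op dot A)
    (n : nat) (Hn : (0 < n)%N)
    (T : 'I_n -> H -> H) (HT : forall k, BA dot A (T k)) :
  A_numerical_radius dot A T ^+ 2 <=
  inf [set Num.sqrt (n%:R : R) / (ab.1 + ab.2) *
           A_numerical_radius dot A
             (fun k x => ab.1%:C *: A_adjoint dot A (T k) (T k x) +
                         ab.2%:C *: T k (A_adjoint dot A (T k) x))
      | ab in [set ab : R * R | 0 <= ab.1 /\ 0 <= ab.2 /\ ab <> (0, 0)]].
Proof.
apply: lb_le_inf.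
  (* The set of the infimum must be inhabited; the pair [(1, 0)] is admissible. *)
  by eexists; exists (1, 0) => //=; split => //; split => // -[/eqP]; rewrite oner_eq0.
move=> _ [[a b] /= [a0 [b0 ab0]] <-].
have ab_gt0 : 0 < a + b.
  rewrite lt0r addr_ge0// andbT paddr_eq0//.
  by apply/negP => /andP[/eqP aE /eqP bE]; apply: ab0; rewrite aE bE.
have /choice[c cP] k := BA_form_bounded Hdot HA (HT k).
rewrite /A_numerical_radius.
set E := [set x | A_norm dot A x = 1].
(* With no A-unit vector both suprema take the value 0. *)
have [->|/set0P[x0 Ex0]] := eqVneq E set0.
  by rewrite !image_set0 sup0 mulr0 expr0n.
set SL := [set _ | x in E]; set SR := [set _ | x in E].
pose d k x := a * form_sqr (A_dot dot A) (T k x) +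
  b * form_sqr (A_dot dot A) (A_adjoint dot A (T k) x).
have q_ge0 := form_sqr_ge0 (A_dot_ge0 HA).
have d_ge0 k x : 0 <= d k x by rewrite addr_ge0// mulr_ge0.
have E1 x : E x -> form_sqr (A_dot dot A) x = 1 by exact: A_norm_eq1.
have SR_d x : E x -> Num.sqrt (\sum_k d k x ^+ 2) <= sup SR.
  move=> Ex; apply: ub_le_sup.
    (* Boundedness of [SR], from the seminorm bounds [c k], makes [sup SR] a genuine upper bound. *)
    exists (Num.sqrt (\sum_k ((a + b) * c k) ^+ 2)) => _ [y Ey <-].
    apply/ler_wsqrtr/ler_sum => k _.
    have [-> _] := BA_form_convex_bound Hdot HA (HT k) (E1 _ Ey) a0 b0.
    have [c1 c2] := cP k y (E1 _ Ey).
    have dc : d k y <= (a + b) * c k by rewrite mulrDl; apply: lerD; apply: ler_wpM2l.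
    by apply: lerXn2r => //; rewrite nnegrE ?d_ge0//; exact: le_trans (d_ge0 k y) dc.
  exists x => //; congr (Num.sqrt _); apply: eq_bigr => k _.
  by have [-> _] := BA_form_convex_bound Hdot HA (HT k) (E1 _ Ex) a0 b0.
set B := Num.sqrt n%:R / (a + b) * sup SR.
have SL_B x : E x -> \sum_k complex.Re `|A_dot dot A (T k x) x| ^+ 2 <= B.
  move=> Ex; rewrite /B mulrAC ler_pdivlMr// mulrC.
  apply: (@le_trans _ _ (\sum_k d k x)).
    rewrite mulr_sumr; apply: ler_sum => k _.
    by have [] := BA_form_convex_bound Hdot HA (HT k) (E1 _ Ex) a0 b0.
  (* Cauchy-Schwarz against the constant vector produces the factor [Num.sqrt n%:R]. *)
  apply: le_trans (ler_wpM2l _ (SR_d x Ex)); last by rewrite sqrtr_ge0.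
  rewrite -sqrtrM// -[leLHS]ger0_norm ?sumr_ge0// -sqrtr_sqr.
  exact/ler_wsqrtr/sqr_sum_le.
have B_ge0 : 0 <= B by apply: le_trans (SL_B _ Ex0); apply: sumr_ge0 => k _; exact: sqr_ge0.
have SL_sqrt : ubound SL (Num.sqrt B) by move=> _ [x Ex <-]; exact/ler_wsqrtr/SL_B.
have SL_ge0 : 0 <= sup SL.
  apply: (@le_trans _ _ (Num.sqrt (\sum_k complex.Re `|A_dot dot A (T k x0) x0| ^+ 2))).
    by rewrite sqrtr_ge0.
  by apply: ub_le_sup; [exists (Num.sqrt B)|exists x0].
rewrite -(sqr_sqrtr B_ge0); apply: lerXn2r; rewrite ?nnegrE ?sqrtr_ge0//.
by apply: ge_sup => //; eexists; exists x0.
Qed.
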